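(* Let $n \ge 2$, let $W$ be a symmetric positive definite real $n\times n$ matrix, and let $\mathbf{y}_1,\ldots,\mathbf{y}_{n-1}\in\mathbb{R}^n$ be non-zero vectors orthogonal to $\mathbf{1}_n$ (for the standard inner product of $\mathbb{R}^n$). Define $M = (\mathbf{1}_n^T W \mathbf{1}_n) I_n + nW$. Then: (a) If $\mathbf{y}_i^T M \mathbf{y}_j = 0$ for all $i\neq j$, then $\{f_n(\mathbf{y}_1),\ldots,f_n(\mathbf{y}_{n-1})\}$ is a $W$-orthogonal basis of $l_n$. (b) If $\{\mathbf{y}_1,\ldots,\mathbf{y}_{n-1}\}$ is an orthogonal basis (for the standard inner product) of the orthogonal complement of $\mathbf{1}_n$ in $\mathbb{R}^n$, then $\{f_n(\mathbf{y}_1),\ldots,f_n(\mathbf{y}_{n-1})\}$ is an orthogonal basis of $l_n$ (for the inner product $\langle A,B\rangle = \mathrm{Tr}(AB^T)$).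
   Context: Vectors in $\mathbb{R}^n$ are columns; $\mathbf{1}_n=[1,\ldots,1]^T\in\mathbb{R}^n$; $I_n$ is the identity matrix; $M_{n,n}$ is the space of real $n\times n$ matrices. The linear map $f_n:\mathbb{R}^n\to M_{n,n}$ is $f_n(\mathbf{v}) = \mathbf{v}\mathbf{1}_n^T - \mathbf{1}_n\mathbf{v}^T$, i.e. $[f_n(\mathbf{v})]_{ij}=v_i-v_j$. The subspace $l_n$ of additively consistent matrices is the set of real skew-symmetric $n\times n$ matrices $B=[b_{ij}]$ with $b_{ij}+b_{jk}+b_{ki}=0$ for all $i,j,k$. For a symmetric positive definite matrix $W$, $\langle A,B\rangle_W=\mathrm{Tr}(AWB^T)$ is an inner product on $M_{n,n}$; ''$W$-orthogonal'' means orthogonal with respect to $\langle\cdot,\cdot\rangle_W$. When $W=I_n$ this is the Frobenius inner product $\langle A,B\rangle=\mathrm{Tr}(AB^T)$, and ''orthogonal'' for matrices refers to it. *)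

(* Defs.v *)
From HB Require Import structures.
From mathcomp Require Import all_boot all_order all_algebra.
From mathcomp Require Import reals.

Set Implicit Arguments.
Unset Strict Implicit.
Unset Printing Implicit Defensive.

Import Order.TTheory GRing.Theory Num.Theory.
Local Open Scope ring_scope.

Definition ones (R : realType) (n : nat) : 'cV[R]_n := const_mx 1.

Definition fmx (R : realType) (n : nat) (v : 'cV[R]_n) : 'M[R]_n :=
  v *m (ones R n)^T - ones R n *m v^T.

Lemma fmxE (R : realType) (n : nat) (v : 'cV[R]_n) (i j : 'I_n) :
  fmx v i j = v i 0 - v j 0.
Proof. by rewrite !mxE !big_ord1 !mxE mulr1 mul1r. Qed.

Definition posdefmx (R : realType) (n : nat) (W : 'M[R]_n) : Prop :=
  W^T = W /\ forall x : 'cV[R]_n, x != 0 -> 0 < (x^T *m W *m x) 0 0.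

Definition dot (R : realType) (n : nat) (u v : 'cV[R]_n) : R :=
  (u^T *m v) 0 0.

Definition mxdot (R : realType) (n : nat) (A B : 'M[R]_n) : R :=
  \tr (A *m B^T).

Definition mxdotW (R : realType) (n : nat) (W A B : 'M[R]_n) : R :=
  \tr (A *m W *m B^T).

(* The basis is an indexed family: basis_of implies that its members are
   pairwise distinct. *)
Definition orthogonal_basis (R : realType) (vT : vectType R)
    (ip : vT -> vT -> R) (U : {vspace vT}) (m : nat) (X : 'I_m -> vT) : Prop :=
  basis_of U [seq X i | i : 'I_m] /\
  forall i j : 'I_m, i != j -> ip (X i) (X j) = 0.

Definition sum_tr (R : realType) (n : nat) (B : 'M[R]_n) : 'M[R]_n := B + B^T.

Lemma sum_tr_is_linear (R : realType) (n : nat) : linear (@sum_tr R n).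
Proof.
by move=> a A B; rewrite /sum_tr linearP scalerDr addrACA.
Qed.

HB.instance Definition _ (R : realType) (n : nat) :=
  GRing.isLinear.Build R 'M[R]_n 'M[R]_n _ (@sum_tr R n)
    (@sum_tr_is_linear R n).

Definition cycle_sum (R : realType) (n : nat) (i j k : 'I_n) (B : 'M[R]_n) :
  R^o := B i j + B j k + B k i.

Lemma cycle_sum_is_linear (R : realType) (n : nat) (i j k : 'I_n) :
  linear (@cycle_sum R n i j k).
Proof.
by move=> a A B; rewrite /cycle_sum !mxE !scalerDr [RHS]addrACA
  [X in _ = X + _]addrACA.
Qed.

HB.instance Definition _ (R : realType) (n : nat) (i j k : 'I_n) :=
  GRing.isLinear.Build R 'M[R]_n R^o _ (@cycle_sum R n i j k)
    (@cycle_sum_is_linear R n i j k).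

Definition consistent (R : realType) (n : nat) : {vspace 'M[R]_n} :=
  (lker (linfun (@sum_tr R n)) :&:
   \bigcap_(i < n) \bigcap_(j < n) \bigcap_(k < n)
     lker (linfun (@cycle_sum R n i j k)))%VS.

Lemma consistentP (R : realType) (n : nat) (B : 'M[R]_n) :
  reflect (B^T = - B /\ forall i j k : 'I_n, B i j + B j k + B k i = 0)
          (B \in consistent R n).
Proof.
rewrite /consistent memv_cap memv_ker lfunE /= /sum_tr addrC addr_eq0.
apply: (iffP andP) => -[skewB cycB]; split; [exact/eqP| |exact/eqP|].
- move=> i j k; move: cycB; rewrite memvE => /subv_bigcapP/(_ i isT).
  move=> /subv_bigcapP/(_ j isT)/subv_bigcapP/(_ k isT).
  by rewrite -memvE memv_ker lfunE => /eqP.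
rewrite memvE; apply/subv_bigcapP => i _; apply/subv_bigcapP => j _.
apply/subv_bigcapP => k _.
by rewrite -memvE memv_ker lfunE /= /cycle_sum cycB.
Qed.

Definition ones_perp (R : realType) (n : nat) : {vspace 'cV[R]_n} :=
  lker (linfun (mulmx (ones R n)^T)).

Lemma ones_perpP (R : realType) (n : nat) (v : 'cV[R]_n) :
  reflect (dot (ones R n) v = 0) (v \in ones_perp R n).
Proof.
rewrite memv_ker lfunE /= /dot; apply: (iffP eqP) => [->|v0].
  by rewrite mxE.
by apply/matrixP => i j; rewrite !ord1 v0 mxE.
Qed.

Definition Mmx (R : realType) (n : nat) (W : 'M[R]_n) : 'M[R]_n :=
  (((ones R n)^T *m W *m ones R n) 0 0)%:M + n%:R *: W.

(* Main.v *)
Require Import Defs.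
From HB Require Import structures.
From mathcomp Require Import all_boot all_order all_algebra.
From mathcomp Require Import reals.

(** For vectors orthogonal to [ones], expanding the product shows that [fmx]
    turns the bilinear form of [Mmx W] into the [W]-inner product:
    [mxdotW W (fmx u) (fmx v) = u^T M v] ([mxdotW_fmx]). The form of [Mmx W] is
    positive definite with [W] ([Mmx_posdef]), so an [M]-orthogonal family of
    nonzero vectors is sent to a [W]-orthogonal family of non-isotropic
    matrices, which is free ([dual_free]). Its [n - 1] members lie in
    [consistent R n], whose dimension is at most [n - 1] because a consistent
    matrix is determined by its first column, where the diagonal entry vanishes
    ([dim_consistent_le]); hence the family is a basis.

    The Frobenius case is [W = 1]: there [Mmx 1] is the scalar matrix [2n], so
    orthogonality for [Mmx 1] is ordinary orthogonality. *)

Set Implicit Arguments.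
Unset Strict Implicit.
Unset Printing Implicit Defensive.

Import Order.TTheory GRing.Theory Num.Theory.
Local Open Scope ring_scope.

Lemma fmx_is_linear (R : realType) (n : nat) : linear (@fmx R n).
Proof.
move=> a u v; apply/matrixP => i j; rewrite fmxE [RHS]mxE [in RHS]mxE !fmxE.
by rewrite !mxE mulrBr opprD addrACA.
Qed.

HB.instance Definition _ (R : realType) (n : nat) :=
  GRing.isLinear.Build R 'cV[R]_n 'M[R]_n _ (@fmx R n) (@fmx_is_linear R n).

Lemma fmx_consistent (R : realType) (n : nat) (v : 'cV[R]_n) :
  fmx v \in consistent R n.
Proof.
apply/consistentP; split=> [|i j k].
  by apply/matrixP => i j; rewrite [LHS]mxE [RHS]mxE !fmxE opprB.
by rewrite !fmxE !subrKA subrr.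
Qed.

(** The cycle condition on the indices [i], [j], [k] gives
    [B i j = B i k - B j k]. *)
Lemma consistent_fmx_col (R : realType) (n : nat) (B : 'M[R]_n) (k : 'I_n) :
  B \in consistent R n -> B = fmx (col k B).
Proof.
move=> /consistentP[skewB cycB]; apply/matrixP => i j; rewrite fmxE !mxE.
have -> : B i k = - B k i by have /matrixP/(_ k i) := skewB; rewrite !mxE.
by apply/eqP; rewrite -subr_eq0 opprB opprK addrA cycB.
Qed.

Lemma dim_consistent_le (R : realType) (n : nat) :
  (\dim (consistent R n) <= n.-1)%N.
Proof.
case: n => [|m] /=; first by rewrite (leq_trans (dimvS (subvf _))) // dimvf.
pose X := [seq fmx (delta_mx (lift ord0 i) 0 : 'cV[R]_m.+1) | i : 'I_m].
suff /dimvS sub : (consistent R m.+1 <= <<X>>)%VS.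
  apply: leq_trans sub (leq_trans (dim_span _) _).
  by rewrite size_image card_ord.
apply/subvP => B cB; have [_ cycB] := consistentP _ cB.
rewrite (consistent_fmx_col ord0 cB) [col _ _]matrix_sum_delta linear_sum.
rewrite big_ord_recl /= big_ord1 mxE.
(* The cycle condition at a repeated index forces a zero diagonal entry. *)
have -> : B ord0 ord0 = 0.
  have /eqP := cycB ord0 ord0 ord0.
  by rewrite -mulr2n -mulrSr mulrn_eq0 /= => /eqP.
rewrite scale0r linear0 add0r; apply: memv_suml => i _.
by rewrite big_ord1 linearZ memvZ // memv_span //; apply/imageP; exists i.
Qed.

(** Orthogonality with respect to a form only enters through the linear
    functionals [ip _ (X i)], which separate the members of the family. *)
Lemma dual_free (K : fieldType) (vT : vectType K) (m : nat)
    (X : 'I_m -> vT) (phi : 'I_m -> {scalar vT}) :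
  (forall i j, i != j -> phi j (X i) = 0) -> (forall i, phi i (X i) != 0) ->
  free [seq X i | i : 'I_m].
Proof.
move=> phi0 phin0; rewrite -[image _ _]/(tval [tuple X i | i < m]).
apply/freeP => k; under eq_bigr do rewrite -tnth_nth tnth_mktuple.
move=> sum0 j; have /(congr1 (phi j)) := sum0.
rewrite linear0 linear_sum (bigD1 j) //= big1 => [|i ij]; rewrite linearZ /=.
  by rewrite addr0 => /eqP; rewrite mulf_eq0 (negPf (phin0 j)) orbF => /eqP.
by rewrite phi0 // mulr0.
Qed.

Lemma posdefmx_ge0 (R : realType) (n : nat) (W : 'M[R]_n) (x : 'cV[R]_n) :
  posdefmx W -> 0 <= (x^T *m W *m x) 0 0.
Proof.
case=> _ W0; have [->|/W0/ltW//] := eqVneq x 0; by rewrite mulmx0 mxE.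
Qed.

Lemma posdefmx1 (R : realType) (n : nat) : posdefmx (1%:M : 'M[R]_n).
Proof.
split=> [|x x0]; first exact: trmx1.
have sq_ge0 (i : 'I_n) : true -> 0 <= x^T 0 i * x i 0.
  by rewrite mxE -expr2 sqr_ge0.
rewrite mulmx1 mxE lt_def sumr_ge0 // andbT; apply: contra x0.
rewrite psumr_eq0 // => /allP xx0; apply/eqP/matrixP => i j.
have := xx0 i (mem_index_enum _); rewrite ord1 !mxE /= -expr2 sqrf_eq0.
by move=> /eqP.
Qed.

Lemma Mmx_posdef (R : realType) (n : nat) (W : 'M[R]_n) :
  posdefmx W -> posdefmx (Mmx W).
Proof.
move=> pW; have [symW W0] := pW; split=> [|x x0].
  by rewrite /Mmx linearD linearZ /= tr_scalar_mx symW.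
have n0 : (0 < n)%N.
  by case: n x x0 {W pW symW W0} => // x; rewrite [x]flatmx0 eqxx.
rewrite mulmxDr mulmxDl mul_mx_scalar -scalemxAr -!scalemxAl mxE.
apply: ltr_wpDl; rewrite mxE.
  rewrite mulr_ge0 ?posdefmx_ge0 //.
  by have := posdefmx_ge0 x (posdefmx1 R n); rewrite mulmx1.
by rewrite mulr_gt0 ?ltr0n ?W0.
Qed.

(** Of the four traces in the expansion, the two mixed ones contain a factor
    [u^T 1] or [1^T v]; the other two are the two summands of [Mmx W]. *)
Lemma mxdotW_fmx (R : realType) (n : nat) (W : 'M[R]_n) (u v : 'cV[R]_n) :
  dot u (ones R n) = 0 -> dot v (ones R n) = 0 ->
  mxdotW W (fmx u) (fmx v) = (u^T *m Mmx W *m v) 0 0.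
Proof.
have dot0 (w : 'cV[R]_n) : dot w (ones R n) = 0 -> w^T *m ones R n = 0.
  by move=> w0; apply/matrixP => i j; rewrite !ord1 [LHS]w0 mxE.
move=> /dot0 u0 /dot0 v0; set e := ones R n in u0 v0 *.
have u0' : e^T *m u = 0 by rewrite -[e^T *m u]trmxK trmx_mul trmxK u0 trmx0.
have ee : e^T *m e = n%:R%:M.
  apply/matrixP => i j; rewrite !ord1 !mxE mulr1n.
  under eq_bigr do rewrite !mxE mulr1.
  by rewrite sumr_const card_ord.
have tr1 (A : 'M[R]_1) : \tr A = A 0 0 by rewrite [LHS]big_ord1.
have outer (a b c d : 'cV[R]_n) :
    \tr (a *m b^T *m W *m (c *m d^T)) = ((d^T *m a) *m (b^T *m W *m c)) 0 0.
  rewrite -tr1 mxtrace_mulC -!mulmxA mxtrace_mulC !mulmxA.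
  by rewrite mxtrace_mulC !mulmxA.
have uv : v^T *m u = u^T *m v.
  by apply/matrixP => i j; rewrite !ord1 -[v^T *m u]trmxK trmx_mul trmxK mxE.
rewrite /mxdotW /fmx -/e linearB /= !trmx_mul !trmxK.
rewrite !mulmxBl !mulmxBr !linearB /= !outer u0' v0 !mul0mx ee uv.
rewrite mul_scalar_mx /Mmx -/e mulmxDr mulmxDl mul_mx_scalar -scalemxAr.
rewrite -!scalemxAl.
rewrite [e^T *m W *m e]mx11_scalar mul_mx_scalar !mxE eqxx mulr1n.
by rewrite subr0 sub0r opprK.
Qed.

Lemma fmx_orthogonal_basis (R : realType) (n : nat) (W : 'M[R]_n)
    (y : 'I_n.-1 -> 'cV[R]_n) :
  posdefmx W -> (forall i, y i != 0) -> (forall i, dot (y i) (ones R n) = 0) ->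
  (forall i j, i != j -> (y i)^T *m Mmx W *m y j = 0) ->
  orthogonal_basis (mxdotW W) (consistent R n) (fun i => fmx (y i)).
Proof.
move=> pW y0 y1 yM.
have orth i j : i != j -> mxdotW W (fmx (y i)) (fmx (y j)) = 0.
  by move=> /yM Mij; rewrite mxdotW_fmx // Mij mxE.
split=> //; rewrite basisEfree; apply/and3P; split.
- pose phi i : {scalar 'M[R]_n} := mxtrace \o mulmxr (W *m (fmx (y i))^T).
  have phiE i A : phi i A = mxdotW W A (fmx (y i)) by rewrite /= mulmxA.
  apply: (@dual_free _ _ _ _ phi) => [i j ij|i]; rewrite phiE.
    exact: orth.
  by rewrite mxdotW_fmx // gt_eqF //; apply: (Mmx_posdef pW).2.
- by apply/span_subvP => _ /imageP[i _ ->]; apply: fmx_consistent.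
- by rewrite size_image card_ord dim_consistent_le.
Qed.

Theorem theorem3p2 (R : realType) (n : nat) (hn : (2 <= n)%N)
    (W : 'M[R]_n) (hW : posdefmx W) (y : 'I_n.-1 -> 'cV[R]_n)
    (y_neq0 : forall i : 'I_n.-1, y i != 0)
    (y_ones : forall i : 'I_n.-1, dot (y i) (ones R n) = 0) :
  ((forall i j : 'I_n.-1, i != j -> (y i)^T *m Mmx W *m y j = 0) ->
   orthogonal_basis (mxdotW W) (consistent R n) (fun i => fmx (y i)))
  /\
  (orthogonal_basis (@dot R n) (ones_perp R n) y ->
   orthogonal_basis (@mxdot R n) (consistent R n) (fun i => fmx (y i))).
Proof.
split=> [|[_ yorth]]; first exact: fmx_orthogonal_basis.
have [|basis orth] := fmx_orthogonal_basis (posdefmx1 R n) y_neq0 y_ones.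
  move=> i j /yorth yij; have {}yij : (y i)^T *m y j = 0.
    by apply/matrixP => k l; rewrite !ord1 [LHS]yij mxE.
  rewrite /Mmx mulmxDr mulmxDl mul_mx_scalar -scalemxAr !mulmx1 -!scalemxAl.
  by rewrite yij !scaler0 addr0.
by split=> // i j /orth; rewrite /mxdotW mulmx1.
Qed.
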